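(* Let $F$ be the free group on two generators and let $\Phi_2 = F/F^{(2)}$ be the free metabelian group on two generators. For every $n \in \mathbb{N}$, $IA'(\Phi_{2,n}) = \mathrm{Inn}(\Phi_{2,n})$.
   Context: $F^{(2)} = [[F,F],[F,F]]$. For $n \in \mathbb{N} = \{1,2,\dots\}$ put $K_{1,n} := [F,F]F^n$, $K_{2,n} := [K_{1,n},K_{1,n}](K_{1,n})^n$ and $\Phi_{2,n} := F/K_{2,n}$, where $H^n$ denotes the subgroup generated by the $n$-th powers of elements of $H$. The kernel of the natural surjection $\Phi_2 \to \Phi_{2,n}$ is characteristic in $\Phi_2$, so there is a natural homomorphism $\mathrm{Aut}(\Phi_2) \to \mathrm{Aut}(\Phi_{2,n})$; its image is denoted $\mathrm{Aut}'(\Phi_{2,n})$. For a group $G$, $IA(G) := \ker(\mathrm{Aut}(G) \to \mathrm{Aut}(G/[G,G]))$. Finally, $IA'(\Phi_{2,n}) := IA(\Phi_{2,n}) \cap \mathrm{Aut}'(\Phi_{2,n})$, and $\mathrm{Inn}$ denotes the group of inner automorphisms. *)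

(* Defs.v *)
From HB Require Import structures.
From mathcomp Require Import all_boot.
From mathcomp Require Import boolp classical_sets.

Set Implicit Arguments.
Unset Strict Implicit.
Unset Printing Implicit Defensive.

Local Open Scope group_scope.
Local Open Scope quotient_scope.
Local Open Scope classical_set_scope.

Section Words.
Variable T : choiceType.

(* The letter (t, true) stands for the generator t, (t, false) for t^-1. *)
Definition letter : Type := (T * bool)%type.
Definition letter_inv (a : letter) : letter := (a.1, ~~ a.2).

Definition reduced (w : seq letter) : bool :=
  sorted (fun a b => b != letter_inv a) w.

Definition push (a : letter) (w : seq letter) : seq letter :=
  if w is b :: w' then if b == letter_inv a then w' else a :: w else [:: a].

Definition word_mul (u v : seq letter) := foldr push v u.
Definition word_inv (u : seq letter) := rev (map letter_inv u).

Lemma letter_invK : involutive letter_inv.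
Proof. by case=> t b; rewrite /letter_inv /= negbK. Qed.

Lemma push_reduced a w : reduced w -> reduced (push a w).
Proof.
case: w => [|b w] //= Hw; case: eqP => [_|/eqP nab]; last by rewrite /= nab.
by move: Hw; case: w => [|c w] //= /andP[].
Qed.

Lemma pushK a w : reduced w -> push a (push (letter_inv a) w) = w.
Proof.
case: w => [|b w] /=; first by rewrite eqxx.
rewrite letter_invK; case: eqP => [->|_] //= Hw; last by rewrite eqxx.
by case: w Hw => [|c w] //= /andP[/negbTE ->].
Qed.

Lemma word_mul_reduced u v : reduced v -> reduced (word_mul u v).
Proof. by move=> Hv; elim: u => //= a u; apply: push_reduced. Qed.

Lemma word_mul_push a t w :
  reduced w -> word_mul (push a t) w = push a (word_mul t w).
Proof.
move=> Hw; case: t => [|b t] //=; case: eqP => [->|] //=.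
by rewrite pushK // word_mul_reduced.
Qed.

Lemma word_mulA u v w :
  reduced w -> word_mul u (word_mul v w) = word_mul (word_mul u v) w.
Proof. by move=> Hw; elim: u => //= a u ->; rewrite word_mul_push. Qed.

Lemma word_mulw0 u : reduced u -> word_mul u [::] = u.
Proof.
elim: u => //= a u IHu Hu; have Ru : reduced u by move/path_sorted: Hu.
by rewrite IHu //; case: u Hu {IHu Ru} => [|b u] //= /andP[/negbTE ->].
Qed.

Lemma word_invK : involutive word_inv.
Proof. by move=> u; rewrite /word_inv map_rev revK; apply: mapK letter_invK u. Qed.

Lemma word_inv_reduced u : reduced u -> reduced (word_inv u).
Proof.
rewrite /reduced /word_inv rev_sorted sorted_map; apply: sub_sorted => a b /=.
by apply: contra => /eqP ab; rewrite ab letter_invK.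
Qed.

Lemma word_mulVw u : word_mul (word_inv u) u = [::].
Proof.
elim: u => //= a u IHu.
by rewrite /word_inv /= rev_cons /word_mul foldr_rcons /= letter_invK eqxx.
Qed.

Record free_group : Type := FreeGroup {fg_word : seq letter; _ : reduced fg_word}.

HB.instance Definition _ := [isSub for fg_word].
HB.instance Definition _ := [Choice of free_group by <:].

Lemma fg_wordP (x : free_group) : reduced (fg_word x).
Proof. exact: valP x. Qed.

Definition fg_one : free_group := @FreeGroup [::] isT.
Definition fg_mul (x y : free_group) : free_group :=
  FreeGroup (word_mul_reduced (fg_word x) (fg_wordP y)).
Definition fg_inv (x : free_group) : free_group :=
  FreeGroup (word_inv_reduced (fg_wordP x)).

Lemma fg_mulA : associative fg_mul.
Proof. by move=> x y z; apply/val_inj/word_mulA/fg_wordP. Qed.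
Lemma fg_mul1g : left_id fg_one fg_mul.
Proof. by move=> x; apply/val_inj. Qed.
Lemma fg_mulg1 : right_id fg_one fg_mul.
Proof. by move=> x; apply/val_inj/word_mulw0/fg_wordP. Qed.
Lemma fg_mulVg : left_inverse fg_one fg_inv fg_mul.
Proof. by move=> x; apply/val_inj/word_mulVw. Qed.
Lemma fg_mulgV : right_inverse fg_one fg_inv fg_mul.
Proof.
move=> x; apply/val_inj => /=.
by rewrite -{1}[fg_word x]word_invK word_mulVw.
Qed.

HB.instance Definition _ := isGroup.Build free_group
  fg_mulA fg_mul1g fg_mulg1 fg_mulVg fg_mulgV.

Definition fg_gen (t : T) : free_group := @FreeGroup [:: (t, true)] isT.

End Words.

Section FreeGroupUniversal.
Variables (T : choiceType) (G : groupType) (f : T -> G).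

Let ev1 (a : letter T) : G := if a.2 then f a.1 else (f a.1)^-1.
Let ev (w : seq (letter T)) : G := foldr (fun a g => ev1 a * g) 1 w.

Let ev1V a : ev1 (letter_inv a) = (ev1 a)^-1.
Proof. by case: a => t [] //=; rewrite /ev1 /= invgK. Qed.

Let ev_push a w : ev (push a w) = ev1 a * ev w.
Proof.
case: w => [|b w] //=; case: eqP => [->|] //=.
by rewrite ev1V mulVKg.
Qed.

Lemma free_group_universal :
  exists! phi : free_group T -> G,
    {morph phi : x y / x * y} /\ forall t, phi (fg_gen t) = f t.
Proof.
exists (fun x => ev (fg_word x)); split.
  split=> [x y|t]; last by rewrite /= /ev1 mulg1.
  rewrite /=; elim: (fg_word x) => [|a u IHu] /=; first by rewrite mul1g.
  by rewrite ev_push IHu mulgA.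
move=> phi [phiM phig]; apply/funext => -[w Hw] /=.
have phi1 : phi 1 = 1.
  by apply: (@mulgI _ (phi 1)); rewrite -phiM !mulg1.
elim: w Hw => [|a w IHw] Hw /=.
  by rewrite -phi1; congr phi; apply/val_inj.
have Ra : reduced [:: a] by [].
have Rw : reduced w by move/path_sorted: (Hw).
have -> : FreeGroup Hw = FreeGroup Ra * FreeGroup Rw.
  apply/val_inj => /=; case: w Hw {IHw Rw} => [|b w] //= /andP[/negbTE -> _] //.
rewrite phiM IHw; congr (_ * _).
case: a {Hw} Ra => t [] Ra; rewrite /ev1 /=.
  by rewrite -phig; congr phi; apply/val_inj.
rewrite -phig; apply: (@mulgI _ (phi (fg_gen t))); rewrite mulgV -phiM -phi1.
by congr phi; apply/val_inj => /=; rewrite eqxx.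
Qed.

End FreeGroupUniversal.

Section Subgroups.
Variable G : groupType.
Implicit Types (A B H : set G).

Definition is_subgroup H : Prop :=
  [/\ H 1, forall x y, H x -> H y -> H (x * y) & forall x, H x -> H x^-1].

Definition is_normal_subgroup H : Prop :=
  is_subgroup H /\ forall x y, H x -> H (x ^ y).

Definition generated A : set G := smallest is_subgroup A.

Definition derived H : set G :=
  generated [set [~ x, y] | x in H & y in H].

Definition power_subgroup H (n : nat) : set G :=
  generated [set x ^+ n | x in H].

Definition set_mul A B : set G := [set x * y | x in A & y in B].

Lemma generated_subgroup A : is_subgroup (generated A).
Proof.
split=> [B HB|x y Ax Ay B HB|x Ax B HB]; case: (HB) => -[B1 BM BV] _.
- exact: B1.
- by apply: BM; [apply: Ax | apply: Ay].
- by apply: BV; apply: Ax.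
Qed.

Lemma sub_generated A : A `<=` generated A.
Proof. exact: sub_gen_smallest. Qed.

Lemma generated_normal A :
  (forall x y, A x -> A (x ^ y)) -> is_normal_subgroup (generated A).
Proof.
move=> AJ; split; first exact: generated_subgroup.
have [g1 gM gV] := generated_subgroup A.
move=> x y Ax; apply: (Ax [set z | generated A (z ^ y)]).
split; last by move=> z Az; exact: (sub_generated (AJ _ _ Az)).
split=> [|a b /= Ha Hb|a /= Ha]; rewrite /= ?conj1g // ?conjMg ?conjVg.
- exact: gM.
- exact: gV.
Qed.

Lemma derived_normal H :
  is_normal_subgroup H -> is_normal_subgroup (derived H).
Proof.
case=> _ HJ; apply: generated_normal => _ z [x Hx [y Hy <-]].
by rewrite conjRg; exists (x ^ z); [apply: HJ | exists (y ^ z); [apply: HJ|]].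
Qed.

Lemma power_subgroup_normal H n :
  is_normal_subgroup H -> is_normal_subgroup (power_subgroup H n).
Proof.
case=> _ HJ; apply: generated_normal => _ z [x Hx <-].
by rewrite conjXg; exists (x ^ z); [apply: HJ|].
Qed.

Lemma set_mul_normal A B : is_normal_subgroup A -> is_normal_subgroup B ->
  is_normal_subgroup (set_mul A B).
Proof.
move=> [[A1 AM AV] AJ] [[B1 BM BV] BJ]; split; first split.
- by exists 1 => //; exists 1 => //; rewrite mulg1.
- move=> _ _ [a Aa [b Bb <-]] [c Ac [d Bd <-]].
  exists (a * c); first exact: AM.
  exists (b ^ c * d); first by apply: BM => //; apply: BJ.
  by rewrite conjgE !mulgA mulgK.
- move=> _ [a Aa [b Bb <-]]; exists a^-1; first exact: AV.
  exists (b^-1 ^ a^-1); first by apply/BJ/BV.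
  by rewrite conjgE invgK !mulgA mulVg mul1g invgM.
- move=> _ z [a Aa [b Bb <-]]; exists (a ^ z); first exact: AJ.
  by exists (b ^ z); [apply: BJ | rewrite conjMg].
Qed.

Lemma setT_normal : is_normal_subgroup [set: G].
Proof. by []. Qed.

End Subgroups.

Record normal_subgroup (G : groupType) := NormalSubgroup {
  normal_set :> set G;
  normal_setP : is_normal_subgroup normal_set
}.

Section Quotient.
Variables (G : groupType) (N : normal_subgroup G).

Definition coset_rel (x y : G) : bool := `[< normal_set N (x^-1 * y) >].

Lemma coset_rel_equiv : equiv_class_of coset_rel.
Proof.
have [[N1 NM NV] NJ] := normal_setP N; split=> [x|x y|y x z].
- by apply/asboolP; rewrite mulVg.
- by apply/asboolP/asboolP => /NV; rewrite invgM invgK.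
- move=> /asboolP xy /asboolP yz; apply/asboolP.
  by have := NM _ _ xy yz; rewrite mulgA mulgK.
Qed.

Canonical coset_equiv := EquivRelPack coset_rel_equiv.

Definition quotient_group : Type := {eq_quot coset_equiv}.

HB.instance Definition _ := Choice.on quotient_group.
HB.instance Definition _ := Quotient.on quotient_group.

Definition coset (x : G) : quotient_group := \pi_quotient_group x.

Lemma eq_coset x y : coset x = coset y <-> normal_set N (x^-1 * y).
Proof.
split=> [/eqP|Nxy]; first by rewrite /coset eqmodE => /asboolP.
by apply/eqP; rewrite /coset eqmodE; apply/asboolP.
Qed.

Lemma coset_repr (X : quotient_group) : coset (repr X) = X.
Proof. exact: reprK. Qed.

Definition quot_one : quotient_group := coset 1.
Definition quot_mul (X Y : quotient_group) : quotient_group :=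
  coset (repr X * repr Y).
Definition quot_inv (X : quotient_group) : quotient_group :=
  coset (repr X)^-1.

Lemma quot_mulE x y : quot_mul (coset x) (coset y) = coset (x * y).
Proof.
have [[N1 NM NV] NJ] := normal_setP N.
have /eq_coset Nx := coset_repr (coset x).
have /eq_coset Ny := coset_repr (coset y).
apply/eq_coset; move: (repr (coset x)) (repr (coset y)) Nx Ny => a b Na Nb.
have -> : (a * b)^-1 * (x * y) = (a^-1 * x) ^ b * (b^-1 * y).
  by rewrite conjgE invgM !mulgA mulgK.
by apply: NM => //; apply: NJ.
Qed.

Lemma quot_invE x : quot_inv (coset x) = coset x^-1.
Proof.
have [[N1 NM NV] NJ] := normal_setP N.
have /eq_coset Nx := coset_repr (coset x).
apply/eq_coset; move: (repr (coset x)) Nx => a /NV /(fun h => NJ _ a^-1 h).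
have -> : ((a^-1 * x)^-1) ^ a^-1 = a * x^-1.
  by rewrite conjgE invgM !invgK mulgK.
by rewrite invgK.
Qed.

Lemma quot_mulA : associative quot_mul.
Proof.
move=> X Y Z; rewrite -(coset_repr X) -(coset_repr Y) -(coset_repr Z).
by rewrite !quot_mulE mulgA.
Qed.
Lemma quot_mul1g : left_id quot_one quot_mul.
Proof. by move=> X; rewrite -(coset_repr X) quot_mulE mul1g. Qed.
Lemma quot_mulg1 : right_id quot_one quot_mul.
Proof. by move=> X; rewrite -(coset_repr X) quot_mulE mulg1. Qed.
Lemma quot_mulVg : left_inverse quot_one quot_inv quot_mul.
Proof. by move=> X; rewrite -(coset_repr X) quot_invE quot_mulE mulVg. Qed.
Lemma quot_mulgV : right_inverse quot_one quot_inv quot_mul.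
Proof. by move=> X; rewrite -(coset_repr X) quot_invE quot_mulE mulgV. Qed.

HB.instance Definition _ := isGroup.Build quotient_group
  quot_mulA quot_mul1g quot_mulg1 quot_mulVg quot_mulgV.

Lemma cosetM : {morph coset : x y / x * y}.
Proof. by move=> x y; rewrite -quot_mulE. Qed.

End Quotient.

Section Automorphisms.
Variable G : groupType.

Definition Aut : set (G -> G) :=
  [set f | {morph f : x y / x * y} /\ bijective f].

Definition Inn : set (G -> G) := [set f | exists g, f = fun x => x ^ g].

Definition derived_group : normal_subgroup G :=
  NormalSubgroup (derived_normal (@setT_normal G)).

Definition abelianization : groupType := quotient_group derived_group.

End Automorphisms.

Arguments Aut G : clear implicits.
Arguments Inn G : clear implicits.

(* [induces p f g]: g is the endomap of Q induced by f through the surjection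
   p : P -> Q. As p is onto, f induces at most one g. *)
Definition induces (P Q : Type) (p : P -> Q) (f : P -> P) (g : Q -> Q) : Prop :=
  forall x, p (f x) = g (p x).

(* The kernel of Aut(G) -> Aut(G/[G,G]). *)
Definition IA (G : groupType) : set (G -> G) :=
  Aut G `&` [set f | induces (@coset G (derived_group G)) f id].

Arguments IA G : clear implicits.

Definition F : groupType := free_group 'I_2.

Definition F_second_derived : normal_subgroup F :=
  NormalSubgroup (derived_normal (derived_normal (@setT_normal F))).

Definition Phi2 : groupType := quotient_group F_second_derived.

Section Levels.
Variable n : nat.

Definition derived_power (G : groupType) (H : set G) : set G :=
  set_mul (derived H) (power_subgroup H n).

Definition K1 : set F := derived_power [set: F].
Definition K2 : set F := derived_power K1.

Lemma derived_power_normal (G : groupType) (H : set G) :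
  is_normal_subgroup H -> is_normal_subgroup (derived_power H).
Proof.
by move=> nH; apply: set_mul_normal;
  [apply: derived_normal | apply: power_subgroup_normal].
Qed.

Lemma K2_normal : is_normal_subgroup K2.
Proof. by do 2!apply: derived_power_normal; apply: setT_normal. Qed.

Definition Phi2n : groupType := quotient_group (NormalSubgroup K2_normal).

Lemma second_derived_sub_K2 : F_second_derived `<=` K2.
Proof.
have sub (H : set F) : derived H `<=` derived_power H.
  move=> x Hx; exists x => //; exists 1; last by rewrite mulg1.
  by have [g1 _ _] := generated_subgroup [set x ^+ n | x in H].
apply: subset_trans (sub K1).
apply: smallest_sub; first exact: generated_subgroup.
move=> _ [x Hx [y Hy <-]].
suff : [set [~ u, v] | u in K1 & v in K1] [~ x, y] by exact: sub_generated.
by exists x; [apply: sub | exists y; [apply: sub|]].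
Qed.

(* The natural surjection, computed on representatives; see natural_mapE. *)
Definition natural_map (X : Phi2) : Phi2n :=
  coset (NormalSubgroup K2_normal) (repr X).

Lemma natural_mapE (x : F) :
  natural_map (coset F_second_derived x) = coset (NormalSubgroup K2_normal) x.
Proof.
have /eq_coset Nx := coset_repr (coset F_second_derived x).
exact/eq_coset/second_derived_sub_K2.
Qed.

(* The image of Aut(Phi2) -> Aut(Phi2n). *)
Definition Aut' : set (Phi2n -> Phi2n) :=
  Aut Phi2n `&`
  [set g | exists2 f, Aut Phi2 f & induces natural_map f g].

Definition IA' : set (Phi2n -> Phi2n) := IA Phi2n `&` Aut'.

End Levels.

Arguments Aut' n : clear implicits.
Arguments IA' n : clear implicits.

(* Main.v *)
Require Import Defs.
From HB Require Import structures.
From mathcomp Require Import all_boot all_algebra.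
From mathcomp Require Import boolp classical_sets.
From Stdlib Require Import Ring.

Set Implicit Arguments.
Unset Strict Implicit.
Unset Printing Implicit Defensive.

Import GRing.Theory.
Local Open Scope ring_scope.
Local Open Scope classical_set_scope.

(** Let n > 1, let R = (Z/n)[(Z/n)^2] and write x, y for the images in R of the
two generators of F. The Fox derivatives D1, D2 : F -> R are the crossed
homomorphisms with D1 x = 1, D1 y = 0 and D2 x = 0, D2 y = 1. The theorem
follows from two facts about them.

The first is a Magnus embedding for Phi_{2,n}: the pair (D1 f, D2 f) determines
f modulo K_{2,n} ([fox_injective]), and by the fundamental formula
D1 f (x - 1) + D2 f (y - 1) = f - 1 the only constraint on a pair (a, b) in the
image is that a (x - 1) + b (y - 1) + 1 be a group element ([fox_surjective]).
Both halves reflect the fact that the Cayley graph of (Z/n)^2 computes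
H_1(K_{1,n}; Z/n), and both come from the same explicit loops, one for each
edge.

The second concerns an endomorphism s of F that lifts an automorphism of Phi_2.
Over the Laurent ring Z[Z^2] the Jacobian determinant of s is invertible by the
chain rule, and the units of Z[Z^2] are the signed monomials. So the Jacobian
determinant over R is a signed group element too ([jacobian_automorphism]).

Now let s induce an IA-automorphism of Phi_{2,n}. Then s(x) x^-1 and s(y) y^-1
lie in the derived subgroup, whose Fox derivatives are the multiples of
(1 - y, x - 1); let p and q be the two multipliers. The Jacobian determinant
is 1 + p (1 - y) + q (x - 1), so this is a signed group element, and its
augmentation 1 shows that the sign does not matter. Hence the pair (q, -p)
satisfies the constraint above and is the Fox derivative of some k in F.
A computation shows that k x k^-1 and s(x) have the same Fox derivatives, and
likewise for y; so s acts on Phi_{2,n} as conjugation by k.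

Conversely, an inner automorphism of Phi_{2,n} lifts to one of Phi_2 and acts
trivially on the abelianization. For n = 1 the group Phi_{2,n} is trivial. *)

(** * Ring identities *)

(** Copies of the ring operations whose carrier is syntactically the sort of S.
The tactic [ring] compares operations up to syntactic equality, while the same
operation of a structure of the hierarchy can be reached by several
inheritance paths; [fold_ring] replaces all of them by these copies. *)
Section Ops.
Variable S : comNzRingType.
Definition rzero : S := 0.
Definition rone : S := 1.
Definition radd (a b : S) : S := a + b.
Definition rmul (a b : S) : S := a * b.
Definition ropp (a : S) : S := - a.
Lemma comRing_theory :
  ring_theory rzero rone radd rmul (fun a b => radd a (ropp b)) ropp eq.
Proof.
split=> *; rewrite /radd /rmul /rzero /rone /ropp ?add0r ?mul1r ?mulrDl ?subrr //.
- exact: addrC.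
- exact: addrA.
- exact: mulrC.
- exact: mulrA.
Qed.
End Ops.

Ltac fold_ring S :=
  repeat match goal with
  | |- context [@Algebra.add ?M ?a ?b] => change (@Algebra.add M a b) with (@radd S a b)
  | |- context [@GRing.mul ?M ?a ?b] => change (@GRing.mul M a b) with (@rmul S a b)
  | |- context [@Algebra.opp ?M ?a] => change (@Algebra.opp M a) with (@ropp S a)
  | |- context [@Algebra.zero ?M] => change (@Algebra.zero M) with (@rzero S)
  | |- context [@GRing.one ?M] => change (@GRing.one M) with (@rone S)
  end;
  repeat match goal with
  | |- context [@eq ?T ?a ?b] =>
     lazymatch T with GRing.ComNzRing.sort S => fail | _ =>
     change (@eq T a b) with (@eq (GRing.ComNzRing.sort S) a b) end
   end.

(** * Free groups and quotient groups *)

Lemma free_group_generated (T : choiceType) (H : set (free_group T)) :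
  is_subgroup H -> (forall t, H (fg_gen t)) -> forall f, H f.
Proof.
move=> [H1 HM HV] Hg [w Hw]; elim: w Hw => [|a w IHw] Hw.
  by have -> : FreeGroup Hw = 1%g by apply/val_inj.
have Ra : reduced [:: a] by [].
have Rw : reduced w by move/path_sorted: (Hw).
have -> : FreeGroup Hw = (FreeGroup Ra * FreeGroup Rw)%g.
  by apply/val_inj => /=; case: w Hw {IHw Rw} => [|b w] //= /andP[/negbTE -> _].
apply: HM => //; case: a Ra {Hw} => t [] Ra.
  by have -> : FreeGroup Ra = fg_gen t by apply/val_inj.
by have -> : FreeGroup Ra = (fg_gen t)^-1%g; [apply/val_inj|apply/HV].
Qed.

Lemma free_group_morph_ext (T : choiceType) (H : groupType)
    (phi psi : free_group T -> H) :
  {morph phi : x y / (x * y)%g} -> {morph psi : x y / (x * y)%g} ->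
  (forall t, phi (fg_gen t) = psi (fg_gen t)) -> phi =1 psi.
Proof.
move=> phiM psiM E.
have [chi [_ uniq_chi]] := free_group_universal (fun t => psi (fg_gen t)).
by move=> f; rewrite -(uniq_chi phi) // -(uniq_chi psi).
Qed.

Section CosetFacts.
Variables (G : groupType) (N : normal_subgroup G).

Lemma coset1 : coset N 1%g = 1%g. Proof. by []. Qed.

Lemma cosetV x : coset N x^-1%g = (coset N x)^-1%g.
Proof. by rewrite -quot_invE. Qed.

Lemma cosetX x k : coset N (x ^+ k)%g = (coset N x ^+ k)%g.
Proof. by elim: k => [|k IHk]; rewrite ?coset1 // !expgS cosetM IHk. Qed.

Lemma derived_sub_power n (H : set G) : derived H `<=` derived_power n H.
Proof.
move=> x Hx; exists x => //; exists 1%g; last by rewrite mulg1.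
by have [g1 _ _] := generated_subgroup [set (x ^+ n)%g | x in H].
Qed.

Lemma power_sub_power n (H : set G) : power_subgroup H n `<=` derived_power n H.
Proof.
move=> x Hx; exists 1%g; last by exists x => //; rewrite mul1g.
by have [g1 _ _] := generated_subgroup [set [~ x, y]%g | x in H & y in H].
Qed.

Variables (n : nat) (H : set G).
Hypothesis HN : derived_power n H `<=` normal_set N.

Lemma coset_commute u v : H u -> H v -> commute (coset N u) (coset N v).
Proof.
move=> Hu Hv; rewrite /commute -!cosetM; apply/eq_coset/HN/derived_sub_power.
apply: sub_generated; exists v => //; exists u => //.
by rewrite commgEl conjgE invgM !mulgA.
Qed.

Lemma coset_expn u : H u -> (coset N u ^+ n)%g = 1%g.
Proof.
move=> Hu; rewrite -cosetX -coset1; apply/esym/eq_coset; rewrite invg1 mul1g.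
by apply/HN/power_sub_power; apply: sub_generated; exists u.
Qed.

End CosetFacts.

(** * Crossed homomorphisms into commutative rings *)

Definition multiplicative_map (G : groupType) (S : comNzRingType) (e : G -> S) :=
  e 1%g = 1 /\ {morph e : f g / (f * g)%g >-> f * g}.

Definition crossed_hom (G : groupType) (S : comNzRingType) (e D : G -> S) :=
  forall f g, D (f * g)%g = D f + e f * D g.

Section CrossedHom.
Variables (G : groupType) (S : comNzRingType) (e : G -> S).
Add Ring S_ring : (comRing_theory S).
Hypothesis me : multiplicative_map e.

Lemma multiplicativeV f : e f^-1%g * e f = 1.
Proof. by case: me => e1 eM; rewrite -eM mulVg. Qed.

Lemma multiplicativeX f k : e (f ^+ k)%g = e f ^+ k.
Proof.
have [e1 eM] := me; elim: k => [|k IHk]; first by rewrite e1.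
by rewrite expgS eM IHk exprS.
Qed.

Variable D : G -> S.
Hypothesis cD : crossed_hom e D.

Lemma crossed_hom1 : D 1%g = 0.
Proof.
have := cD 1%g 1%g; rewrite mulg1 me.1 mul1r => /eqP.
by rewrite -{1}[D 1%g]addr0 (inj_eq (addrI _)) => /eqP.
Qed.

Lemma crossed_homV f : D f^-1%g = - (e f^-1%g * D f).
Proof. by apply/eqP; rewrite -addr_eq0 -cD mulVg crossed_hom1. Qed.

Lemma crossed_homJ f g :
  D (f * g * f^-1)%g = (1 - e (f * g * f^-1)%g) * D f + e f * D g.
Proof.
have [e1 eM] := me.
have h := multiplicativeV f.
rewrite !cD crossed_homV !eM; move: h; fold_ring S => h; ring [h].
Qed.

(** Multiplying by [e (g * f)] avoids inverses: expand [D] on both sides of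
[f * g = g * f * [~ f, g]]. *)
Lemma crossed_homR f g :
  e (g * f)%g * D [~ f, g]%g = (1 - e g) * D f + (e f - 1) * D g.
Proof.
have [e1 eM] := me.
have : D (f * g)%g = D (g * f * [~ f, g])%g by rewrite -commgC.
rewrite [RHS]cD !cD => h; apply: (addrI (D g + e g * D f)).
rewrite -h; fold_ring S; ring.
Qed.

Lemma crossed_hom_kernel :
  is_subgroup [set f | e f = 1 /\ D f = 0].
Proof.
have [e1 eM] := me; split=> [|f g [ef Df] [eg Dg]|f [ef Df]].
- by split; rewrite ?crossed_hom1.
- by rewrite /= eM cD ef eg Df Dg mulr0 mulr1 addr0.
- rewrite /= crossed_homV Df mulr0 oppr0; split=> //.
  by have := multiplicativeV f; rewrite ef mulr1.
Qed.

(** Where [e] is 1 a crossed homomorphism is an ordinary homomorphism to the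
additive group of [S], so it kills commutators, and also n-th powers if
n = 0 in [S]. *)
Lemma crossed_hom_derived (H : set G) : (forall f, H f -> e f = 1) ->
  forall f, derived H f -> e f = 1 /\ D f = 0.
Proof.
have [e1 eM] := me.
move=> eH f; apply: (smallest_sub crossed_hom_kernel) => _ [a Ha [b Hb <-]] /=.
have eV c : H c -> e c^-1%g = 1.
  by move=> Hc; have := multiplicativeV c; rewrite (eH _ Hc) mulr1.
split; first by rewrite commgEl conjgE !eM !eV // !eH // !mulr1.
have := crossed_homR a b; rewrite eM !(eH a) // !(eH b) // !mulr1 mul1r => ->.
by rewrite subrr !mul0r addr0.
Qed.

Lemma crossed_hom_power (H : set G) n : is_subgroup H ->
  (forall f, H f -> e f = 1) -> n%:R = 0 :> S ->
  forall f, power_subgroup H n f -> e f = 1 /\ D f = 0.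
Proof.
have [e1 eM] := me.
move=> [H1 HM _] eH n0 f.
apply: (smallest_sub crossed_hom_kernel) => _ [a Ha <-] /=.
suff [-> ->] : e (a ^+ n)%g = 1 /\ D (a ^+ n)%g = n%:R * D a.
  by rewrite n0 mul0r.
elim: n {n0} => [|n [IHe IHD]]; first by rewrite mul0r crossed_hom1.
rewrite expgS eM cD IHe IHD eH //; split; first by rewrite mulr1.
by rewrite mul1r mulrS mulrDl mul1r.
Qed.

End CrossedHom.

Lemma multiplicative_map_derived (G : groupType) (S : comNzRingType)
    (e : G -> S) :
  multiplicative_map e -> forall f, derived [set: G] f -> e f = 1.
Proof.
move=> me; have [e1 eM] := me.
move=> f; apply: (_ : _ `<=` [set g | e g = 1]); apply: smallest_sub.
  split=> [//|a b /= ea eb|a /= ea]; first by rewrite eM ea eb mulr1.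
  by have := multiplicativeV me a; rewrite ea mulr1.
move=> _ [a _ [b _ <-]] /=; rewrite commgEl conjgE !eM.
rewrite [e b^-1%g * _]mulrCA [e b^-1%g * _](multiplicativeV me) mulr1.
exact: multiplicativeV.
Qed.

Lemma crossed_hom_congr (G : groupType) (S : comNzRingType) (e D : G -> S) f g :
  crossed_hom e D -> D (f^-1 * g)%g = 0 -> D g = D f.
Proof. by move=> cD Dfg; rewrite -[g](mulVKg f) cD Dfg mulr0 addr0. Qed.

Section FreeCrossedHom.
Variables (T : choiceType) (S : comNzRingType) (e : free_group T -> S).
Hypothesis me : multiplicative_map e.

Lemma crossed_hom_ext D D' : crossed_hom e D -> crossed_hom e D' ->
  (forall t, D (fg_gen t) = D' (fg_gen t)) -> D =1 D'.
Proof.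
move=> cD cD' DD'; apply: (@free_group_generated _ [set f | D f = D' f]) => //.
split=> [|f g /= fE gE|f /= fE].
- by rewrite /= (crossed_hom1 me cD) (crossed_hom1 me cD').
- by rewrite cD cD' fE gE.
- by rewrite (crossed_homV me cD) (crossed_homV me cD') fE.
Qed.

(** A crossed homomorphism with values [d] on the generators is the second
component of the homomorphism [t |-> (t, d t)] to this semidirect product. *)
Definition semidirect of multiplicative_map e : Type := (free_group T * S)%type.
HB.instance Definition _ := Choice.on (semidirect me).

Definition sd_mul (a b : semidirect me) : semidirect me :=
  ((a.1 * b.1)%g, a.2 + e a.1 * b.2).
Definition sd_inv (a : semidirect me) : semidirect me :=
  (a.1^-1%g, - (e a.1^-1%g * a.2)).

Lemma sd_mulA : associative sd_mul.
Proof.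
by move=> a b c; rewrite /sd_mul /= mulgA me.2 mulrDr addrA mulrA.
Qed.
Lemma sd_mul1g : left_id (1%g, 0) sd_mul.
Proof. by move=> [f a]; rewrite /sd_mul /= mul1g me.1 mul1r add0r. Qed.
Lemma sd_mulg1 : right_id (1%g, 0) sd_mul.
Proof. by move=> [f a]; rewrite /sd_mul /= mulg1 mulr0 addr0. Qed.
Lemma sd_mulVg : left_inverse (1%g, 0) sd_inv sd_mul.
Proof. by move=> [f a]; rewrite /sd_mul /= mulVg addNr. Qed.
Lemma sd_mulgV : right_inverse (1%g, 0) sd_inv sd_mul.
Proof.
move=> [f a]; rewrite /sd_mul /= mulgV mulrN mulrA -me.2 mulgV me.1 mul1r.
by rewrite subrr.
Qed.

HB.instance Definition _ := isGroup.Build (semidirect me)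
  sd_mulA sd_mul1g sd_mulg1 sd_mulVg sd_mulgV.

Lemma crossed_hom_exists (d : T -> S) :
  exists2 D, crossed_hom e D & forall t, D (fg_gen t) = d t.
Proof.
have [phi [[phiM phig] _]] :=
  free_group_universal (fun t => (fg_gen t, d t) : semidirect me).
have phi1 f : (phi f).1 = f.
  have [id' [_ uniq_id]] := free_group_universal (@fg_gen T).
  transitivity (id' f); last first.
    by rewrite (uniq_id id) //.
  rewrite (uniq_id (fun f => (phi f).1)) //; split=> [a b|t].
    by rewrite phiM.
  by rewrite phig.
exists (fun f => (phi f).2) => [f g|t]; last by rewrite phig.
by rewrite phiM /= phi1.
Qed.

End FreeCrossedHom.

(** * Fox derivatives and Jacobians *)

Definition gx : F := fg_gen (ord0 : 'I_2).
Definition gy : F := fg_gen (ord_max : 'I_2).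

Lemma ord2_ind (P : 'I_2 -> Prop) : P ord0 -> P ord_max -> forall t, P t.
Proof.
move=> P0 P1 [[|[|//]] lt_t2].
- by rewrite (_ : Ordinal _ = ord0) //; apply/val_inj.
- by rewrite (_ : Ordinal _ = ord_max) //; apply/val_inj.
Qed.

(** The Fox derivatives with coefficients pushed forward along [e]. Keeping [e]
general makes the chain rule expressible: the derivatives of a composite with
[s] involve the derivatives relative to [e \o s]. *)
Record fox_pair (S : comNzRingType) (e D1 D2 : F -> S) : Prop := FoxPair {
  fox_mul : multiplicative_map e;
  fox_crossed1 : crossed_hom e D1;
  fox_crossed2 : crossed_hom e D2;
  fox1x : D1 gx = 1; fox1y : D1 gy = 0;
  fox2x : D2 gx = 0; fox2y : D2 gy = 1
}.

Lemma fox_pair_exists (S : comNzRingType) (e : F -> S) :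
  multiplicative_map e -> exists D1 D2, fox_pair e D1 D2.
Proof.
move=> me.
have [D1 cD1 D1g] := crossed_hom_exists me (fun t : 'I_2 => (t == ord0)%:R).
have [D2 cD2 D2g] := crossed_hom_exists me (fun t : 'I_2 => (t == ord_max)%:R).
by exists D1, D2; split; rewrite // /gx /gy ?D1g ?D2g.
Qed.

(** The determinant of the Fox matrix of the endomorphism [gx |-> u],
[gy |-> v]. *)
Definition jacobian (S : comNzRingType) (D1 D2 : F -> S) (u v : F) : S :=
  D1 u * D2 v - D2 u * D1 v.

Section Fox.
Variable S : comNzRingType.
Add Ring S_ring : (comRing_theory S).

Lemma crossed_hom_comb (G : groupType) (e D D' : G -> S) a b :
  crossed_hom e D -> crossed_hom e D' ->
  crossed_hom e (fun f => D f * a + D' f * b).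
Proof. by move=> cD cD' f g; rewrite cD cD'; fold_ring S; ring. Qed.

(** The Fox derivatives form a basis of the module of crossed homomorphisms.
Applied to [D \o s] this is the chain rule, and applied to [e - 1] it is the
fundamental formula. *)
Lemma fox_expand (e D1 D2 D : F -> S) : fox_pair e D1 D2 ->
  crossed_hom e D -> forall f, D f = D1 f * D gx + D2 f * D gy.
Proof.
move=> [me c1 c2 x1 y1 x2 y2] cD.
apply: (crossed_hom_ext me cD); first exact: crossed_hom_comb.
apply: ord2_ind; rewrite -/gx -/gy ?x1 ?x2 ?y1 ?y2; fold_ring S; ring.
Qed.

Lemma crossed_hom_sub1 (G : groupType) (e : G -> S) : multiplicative_map e ->
  crossed_hom e (fun f => e f - 1).
Proof. by move=> [_ eM] f g; rewrite eM; fold_ring S; ring. Qed.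

Lemma fox_fundamental (e D1 D2 : F -> S) : fox_pair e D1 D2 ->
  forall f, e f - 1 = D1 f * (e gx - 1) + D2 f * (e gy - 1).
Proof.
move=> fD; exact: (fox_expand fD (crossed_hom_sub1 (fox_mul fD))).
Qed.

Lemma jacobian_chain (e D1 D2 D1' D2' : F -> S) (s : F -> F) :
  {morph s : f g / (f * g)%g} ->
  fox_pair e D1 D2 -> fox_pair (e \o s) D1' D2' -> forall u v,
  jacobian D1 D2 (s u) (s v) =
  jacobian D1' D2' u v * jacobian D1 D2 (s gx) (s gy).
Proof.
move=> sM fD fD' u v.
have c1 : crossed_hom (e \o s) (D1 \o s).
  by move=> f g /=; rewrite sM (fox_crossed1 fD).
have c2 : crossed_hom (e \o s) (D2 \o s).
  by move=> f g /=; rewrite sM (fox_crossed2 fD).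
have E1 := fox_expand fD' c1; have E2 := fox_expand fD' c2.
rewrite /= in E1 E2.
rewrite /jacobian (E1 u) (E1 v) (E2 u) (E2 v).
by fold_ring S; ring.
Qed.

Lemma fox_second_derived (e D1 D2 : F -> S) : fox_pair e D1 D2 ->
  forall f, normal_set F_second_derived f -> D1 f = 0 /\ D2 f = 0.
Proof.
move=> [me c1 c2 _ _ _ _] f Ff.
have e1 := multiplicative_map_derived me.
by split; [case: (crossed_hom_derived me c1 e1 Ff)
  |case: (crossed_hom_derived me c2 e1 Ff)].
Qed.

(** By the chain rule the Jacobians of [s] and [t] multiply to that of
[s \o t], and Fox derivatives cannot see the second derived subgroup, on which
[s \o t] differs from the identity. *)
Lemma jacobian_unit (e D1 D2 D1' D2' : F -> S) (s t : F -> F) :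
  {morph s : f g / (f * g)%g} ->
  (forall f, normal_set F_second_derived (f^-1 * s (t f))%g) ->
  fox_pair e D1 D2 -> fox_pair (e \o s) D1' D2' ->
  jacobian D1' D2' (t gx) (t gy) * jacobian D1 D2 (s gx) (s gy) = 1.
Proof.
move=> sM st fD fD'; rewrite -(jacobian_chain sM fD fD').
have E1 f : D1 (s (t f)) = D1 f.
  apply: (crossed_hom_congr (fox_crossed1 fD)).
  by case: (fox_second_derived fD (st f)).
have E2 f : D2 (s (t f)) = D2 f.
  apply: (crossed_hom_congr (fox_crossed2 fD)).
  by case: (fox_second_derived fD (st f)).
rewrite /jacobian !E1 !E2; case: fD => _ _ _ -> -> -> ->.
by rewrite mulr1 mulr0 subr0.
Qed.

(** Substitute the fundamental formula for [f] and for [g] in [crossed_homR];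
the multiplier [p] is, up to a group element, the 2 x 2 minor of the Fox
derivatives of [f] and [g]. *)
Lemma derived_fox (e D1 D2 : F -> S) : fox_pair e D1 D2 ->
  forall f g, exists p,
    D1 [~ f, g]%g = p * (1 - e gy) /\ D2 [~ f, g]%g = p * (e gx - 1).
Proof.
move=> fD f g; have [me c1 c2 _ _ _ _] := fD.
exists (e (g * f)^-1%g * (D1 f * D2 g - D2 f * D1 g)).
have h := multiplicativeV me (g * f)%g.
have hf := fox_fundamental fD f.
have hg : 1 - e g = - (D1 g * (e gx - 1) + D2 g * (e gy - 1)).
  by rewrite -fox_fundamental // opprB.
have r1 := crossed_homR me c1 f g; have r2 := crossed_homR me c2 f g.
rewrite hf hg in r1; rewrite hf hg in r2.
split.
  rewrite -[LHS]mul1r -{1}h -mulrA r1; fold_ring S; ring.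
rewrite -[LHS]mul1r -{1}h -mulrA r2; fold_ring S; ring.
Qed.

End Fox.

(** * Units of the Laurent polynomial ring in two variables *)

Section PolyUnits.
Variable R : idomainType.

(** Induction on the exponent: if it is positive, the variable divides one of
the factors, since one of the two constant coefficients vanishes. *)
Lemma factor_of_monomial (P Q : {poly R}) c k : c != 0 -> P * Q = c *: 'X^k ->
  exists a b i, a * b = c /\ P = a *: 'X^i.
Proof.
move=> c0; elim: k P Q => [|k IHk] P Q PQ.
  have := size_mul_eq1 P Q; rewrite PQ expr0 alg_polyC size_polyC c0 eqxx.
  case/esym/andP=> /size_poly1P[a _ Pa] /size_poly1P[b _ Qb].
  exists a, b, 0%N; rewrite Pa expr0 alg_polyC; split=> //.
  by move: PQ; rewrite Pa Qb expr0 alg_polyC -polyCM => /polyC_inj.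
have : P`_0 * Q`_0 = 0 by rewrite -coef0M PQ coefZ coefXn mulr0.
have X0 : ('X : {poly R}) != 0 by rewrite polyX_eq0.
have split0 (p : {poly R}) : p`_0 = 0 -> exists p', p = p' * 'X.
  move=> p0; exists (\poly_(i < size p) p`_i.+1); apply/polyP=> -[|i].
    by rewrite coefMX.
  rewrite coefMX /= coef_poly; case: ltnP => // le_p.
  by rewrite nth_default // (leq_trans le_p).
move/eqP; rewrite mulf_eq0 => /orP[]/eqP/split0[p' E].
  have [|a [b [i [ab P'E]]]] := IHk p' Q.
    by apply: (mulIf X0); rewrite mulrAC -E PQ exprSr scalerAl.
  by exists a, b, i.+1; rewrite E P'E exprSr scalerAl.
apply: (IHk P p'); apply: (mulIf X0).
by rewrite -mulrA -E PQ exprSr scalerAl.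
Qed.

End PolyUnits.

Lemma int_unit_sign (a b : int) : a * b = 1 -> a = 1 \/ a = -1.
Proof.
move=> ab; have : a \is a GRing.unit by apply/unitrPr; exists b.
by rewrite /in_mem /= => /orP[]/eqP->; [left|right].
Qed.

(** In (Z[Y])[X] the variables are ['X] and ['X%:P]: peel off the powers of X,
then the powers of Y. *)
Lemma factor_of_int_monomial (P Q : {poly {poly int}}) k :
  P * Q = ('X * 'X%:P) ^+ k ->
  exists (a : int) i j, (a = 1 \/ a = -1) /\ P = a%:~R * ('X ^+ i * 'X%:P ^+ j).
Proof.
move=> PQ.
have X0 : ('X^k : {poly int}) != 0 by rewrite expf_neq0 // polyX_eq0.
have [|a [b [i [ab PE]]]] := @factor_of_monomial _ P Q ('X^k) k X0.
  by rewrite PQ exprMn -rmorphXn /= mulrC mul_polyC.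
have [||c [d [j [cd aE]]]] := @factor_of_monomial _ a b 1 k; first exact: oner_neq0.
  by rewrite scale1r.
have c1 := int_unit_sign cd; exists c, i, j; split=> //.
have E : 'X^j *: 'X^i = 'X^i * 'X%:P ^+ j :> {poly {poly int}}.
  by rewrite -mul_polyC rmorphXn mulrC.
rewrite PE aE; case: c1 => ->; first by rewrite scale1r E mul1r.
by rewrite scaleN1r scaleNr E mulN1r.
Qed.

(** [ev] embeds Z[X, Y] in a ring where X and Y become the units [e gx] and
[e gy]; the image of Z[X, 1/X, Y, 1/Y] is singled out by [laurent], clearing
denominators with powers of XY. *)
Section Laurent.
Variables (S : comNzRingType) (ev : {rmorphism {poly {poly int}} -> S}).
Variable e : F -> S.
Hypotheses (me : multiplicative_map e) (ev_inj : injective ev).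
Hypotheses (ex : e gx = ev 'X) (ey : e gy = ev 'X%:P).
Add Ring S_ring : (comRing_theory S).

Let Z : {poly {poly int}} := 'X * 'X%:P.

Definition laurent (u : S) := exists N P, u * ev Z ^+ N = ev P.

Lemma laurent_ev P : laurent (ev P).
Proof. by exists 0%N, P; rewrite mulr1. Qed.

Lemma laurentD u v : laurent u -> laurent v -> laurent (u + v).
Proof.
move=> [N [P uP]] [M [Q vQ]]; exists (N + M)%N, (P * Z ^+ M + Q * Z ^+ N).
rewrite rmorphD [ev (P * _)]rmorphM [ev (Q * _)]rmorphM ![ev (Z ^+ _)]rmorphXn.
rewrite -uP -vQ exprD /=; set a := _ ^+ N; set b := _ ^+ M.
by fold_ring S; ring.
Qed.

Lemma laurentM u v : laurent u -> laurent v -> laurent (u * v).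
Proof.
move=> [N [P uP]] [M [Q vQ]]; exists (N + M)%N, (P * Q).
rewrite exprD rmorphM -uP -vQ; set a := _ ^+ N; set b := _ ^+ M.
by fold_ring S; ring.
Qed.

Lemma laurentN u : laurent u -> laurent (- u).
Proof. by move=> [N [P uP]]; exists N, (- P); rewrite mulNr uP rmorphN. Qed.

Lemma laurent_multiplicative f : laurent (e f).
Proof.
have [e1 eM] := me.
suff [] : laurent (e f) /\ laurent (e f^-1%g) by [].
apply: (@free_group_generated _
  [set g | laurent (e g) /\ laurent (e g^-1%g)]) => [|t].
  split=> [|g h [Lg LVg] [Lh LVh]|g [Lg LVg]] /=; last by rewrite invgK.
    by rewrite invg1 e1 -(rmorph1 ev); split; apply: laurent_ev.
  by rewrite invgM !eM; split; apply: laurentM.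
have VX := multiplicativeV me gx; have VY := multiplicativeV me gy.
move: t; apply: ord2_ind; rewrite -/gx -/gy /=; split.
- by rewrite ex; apply: laurent_ev.
- by exists 1%N, 'X%:P; rewrite expr1 rmorphM /= -ex -ey mulrA VX mul1r.
- by rewrite ey; apply: laurent_ev.
- by exists 1%N, 'X; rewrite expr1 rmorphM /= -ex -ey mulrCA VY mulr1.
Qed.

Lemma laurent_crossed_hom (e' D : F -> S) : multiplicative_map e' ->
  (forall f, laurent (e' f)) -> crossed_hom e' D ->
  laurent (D gx) -> laurent (D gy) -> forall f, laurent (D f).
Proof.
move=> me' Le' cD Dx Dy f.
apply: (@free_group_generated _ [set f | laurent (D f)]); last exact: ord2_ind.
split=> [|g h Lg Lh|g Lg] /=.
- by rewrite (crossed_hom1 me' cD) -(rmorph0 ev); apply: laurent_ev.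
- by rewrite cD; apply: laurentD => //; apply: laurentM.
- by rewrite (crossed_homV me' cD); apply/laurentN/laurentM.
Qed.

Lemma laurent_jacobian (e' D1 D2 : F -> S) u v :
  (forall f, laurent (e' f)) -> fox_pair e' D1 D2 ->
  laurent (jacobian D1 D2 u v).
Proof.
move=> Le' [me' c1 c2 x1 y1 x2 y2].
have [L0 L1] : laurent 0 /\ laurent 1.
  by rewrite -(rmorph0 ev) -(rmorph1 ev); split; apply: laurent_ev.
have LD1 := laurent_crossed_hom me' Le' c1; rewrite x1 y1 in LD1.
have {}LD1 := LD1 L1 L0.
have LD2 := laurent_crossed_hom me' Le' c2; rewrite x2 y2 in LD2.
have {}LD2 := LD2 L0 L1.
rewrite /jacobian; apply: laurentD; last apply: laurentN.
  by apply: laurentM; auto.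
by apply: laurentM.
Qed.

(** After clearing denominators, [u * v = 1] becomes a factorization of a power
of XY in Z[X, Y]. *)
Lemma laurent_unit u v : laurent u -> laurent v -> u * v = 1 ->
  exists (a : int) h, (a = 1 \/ a = -1) /\ u = a%:~R * e h.
Proof.
have [e1 eM] := me.
move=> [N [P uP]] [M [Q vQ]] uv.
have PQ : P * Q = Z ^+ (N + M).
  apply: ev_inj; rewrite rmorphM rmorphXn /= -uP -vQ exprD mulrACA uv mul1r //.
have [a [i [j [a1 PE]]]] := factor_of_int_monomial PQ.
have zN : e ((gx * gy) ^+ N)%g = ev Z ^+ N.
  by rewrite multiplicativeX // eM ex ey -rmorphM.
exists a, ((gx ^+ i * gy ^+ j) * ((gx * gy) ^+ N)^-1)%g; split=> //.
have VN := multiplicativeV me ((gx * gy) ^+ N)%g.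
rewrite -[LHS]mulr1 -{1}VN mulrCA zN uP PE rmorphM rmorph_int.
rewrite !eM !multiplicativeX //.
by rewrite rmorphM !rmorphXn /= ex ey mulrC !mulrA.
Qed.

Lemma jacobian_automorphism_laurent (D1 D2 : F -> S) (s t : F -> F) :
  fox_pair e D1 D2 ->
  {morph s : f g / (f * g)%g} ->
  (forall f, normal_set F_second_derived (f^-1 * s (t f))%g) ->
  exists (a : int) h, (a = 1 \/ a = -1) /\
    jacobian D1 D2 (s gx) (s gy) = a%:~R * e h.
Proof.
move=> fD sM st.
have s1 : s 1%g = 1%g by apply: (@mulgI _ (s 1%g)); rewrite -sM !mulg1.
have mes : multiplicative_map (e \o s).
  by have [e1 eM] := me; split=> [|f g] /=; rewrite ?s1 // sM eM.
have [D1' [D2' fD']] := fox_pair_exists mes.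
have := jacobian_unit sM st fD fD'; rewrite mulrC => JJ.
apply: (laurent_unit _ _ JJ); apply: laurent_jacobian; eauto.
- exact: laurent_multiplicative.
- move=> f; exact: laurent_multiplicative.
Qed.

End Laurent.

(** * Jacobians of automorphisms of the free metabelian group *)

Section Pairing.
Variables (A S1 S2 : comNzRingType).
Variables (f1 : {rmorphism A -> S1}) (f2 : {rmorphism A -> S2}).
Definition pairing (a : A) : (S1 * S2)%type := (f1 a, f2 a).
Fact pairing_is_zmod_morphism : zmod_morphism pairing.
Proof. by move=> a b; rewrite /pairing !rmorphB. Qed.
HB.instance Definition _ := GRing.isZmodMorphism.Build A (S1 * S2)%type pairing
  pairing_is_zmod_morphism.
Fact pairing_is_monoid_morphism : monoid_morphism pairing.
Proof. by split=> [|a b]; rewrite /pairing ?rmorph1 ?rmorphM. Qed.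
HB.instance Definition _ := GRing.isMonoidMorphism.Build A (S1 * S2)%type pairing
  pairing_is_monoid_morphism.
End Pairing.

(** Over a ring where Z[X, Y] embeds this is
[jacobian_automorphism_laurent]. A general [R] is
reached as the second factor of Frac(Z[X, Y]) x R: the first factor makes the
evaluation of polynomials injective, and the second one carries the conclusion
over to [R]. *)
Lemma jacobian_automorphism (R : comNzRingType) (e D1 D2 : F -> R)
    (s t : F -> F) :
  fox_pair e D1 D2 ->
  {morph s : f g / (f * g)%g} ->
  (forall f, normal_set F_second_derived (f^-1 * s (t f))%g) ->
  exists (a : int) h, (a = 1 \/ a = -1) /\
    jacobian D1 D2 (s gx) (s gy) = a%:~R * e h.
Proof.
move=> fD sM st.
have [e1 eM] := fox_mul fD.
have m1 : multiplicative_map (fun f : F => 1 : int).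
  by split=> // f g; rewrite mulr1.
(* With trivial action, Fox derivatives are the exponent sums. *)
have [i [j [_ ci cj ix iy jx jy]]] := fox_pair_exists m1.
pose S0 : fieldType := {fraction {poly {poly int}}}.
pose X : S0 := tofrac 'X; pose Y : S0 := tofrac 'X%:P.
have X0 : X != 0 by rewrite tofrac_eq0 polyX_eq0.
have Y0 : Y != 0 by rewrite tofrac_eq0 polyC_eq0 polyX_eq0.
pose e0 (f : F) : S0 := X ^ i f * Y ^ j f.
have me0 : multiplicative_map e0.
  split.
    by rewrite /e0 (crossed_hom1 m1 ci) (crossed_hom1 m1 cj) !expr0z mulr1.
  by move=> f g; rewrite /e0 ci cj !mul1r !expfzDr // mulrACA.
pose evy := horner_morph (fun n : int => mulrC (e gy) (n%:~R)).
pose evR := horner_morph (fun p => mulrC (e gx) (evy p)).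
pose ev := pairing (@tofrac {poly {poly int}}) evR.
pose ee (f : F) : (S0 * R)%type := (e0 f, e f).
have mee : multiplicative_map ee.
  by have [e01 e0M] := me0; split=> [|f g]; rewrite /ee ?e01 ?e1 ?e0M ?eM.
have [E1 [E2 fE]] := fox_pair_exists mee.
have ev_inj : injective ev.
  by move=> P Q [/eqP]; rewrite tofrac_eq => /eqP.
have exE : ee gx = ev 'X.
  rewrite /ee /e0 ix jx expr1z expr0z mulr1.
  by congr (_, _); symmetry; apply: horner_morphX.
have eyE : ee gy = ev 'X%:P.
  rewrite /ee /e0 iy jy expr1z expr0z mul1r.
  congr (_, _); symmetry; rewrite /evR [LHS]horner_morphC.
  exact: horner_morphX.
have [a [h [a1 Ja]]] := jacobian_automorphism_laurent mee ev_inj exE eyE fE sM st.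
exists a, h; split=> //.
have D1E f : (E1 f).2 = D1 f.
  have c1 : crossed_hom e (fun f => (E1 f).2).
    by move=> f' g'; rewrite (fox_crossed1 fE).
  by rewrite (fox_expand fD c1) (fox1x fE) (fox1y fE) mulr1 mulr0 addr0.
have D2E f : (E2 f).2 = D2 f.
  have c2 : crossed_hom e (fun f => (E2 f).2).
    by move=> f' g'; rewrite (fox_crossed2 fE).
  by rewrite (fox_expand fD c2) (fox2x fE) (fox2y fE) mulr1 mulr0 add0r.
have := congr1 snd Ja; rewrite /jacobian /= -!D1E -!D2E => ->.
by case: a1 {Ja} => ->.
Qed.

(** * The group algebra of a finite abelian group *)

Section GroupAlgebra.
Variables (G : finZmodType) (A : comNzRingType).

Definition group_algebra : Type := {ffun G -> A}.
HB.instance Definition _ := GRing.Zmodule.copy group_algebra {ffun G -> A}.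

Implicit Types a b c : group_algebra.

Definition ga_fun a : G -> A := fun g => (a : {ffun G -> A}) g.

Definition ga_delta (g : G) : group_algebra := [ffun h => (h == g)%:R].
Definition ga_mul a b : group_algebra :=
  [ffun g => \sum_h ga_fun a h * ga_fun b (g - h)].

Lemma ga_ext a b : ga_fun a =1 ga_fun b -> a = b.
Proof. by move=> ab; apply/ffunP => g; apply: ab. Qed.

Lemma ga_funD a b g : ga_fun (a + b) g = ga_fun a g + ga_fun b g.
Proof. by rewrite /ga_fun ffunE. Qed.
Lemma ga_funN a g : ga_fun (- a) g = - ga_fun a g.
Proof. by rewrite /ga_fun ffunE. Qed.
Lemma ga_fun0 g : ga_fun 0 g = 0.
Proof. by rewrite /ga_fun ffunE. Qed.
Lemma ga_fun_delta g h : ga_fun (ga_delta g) h = (h == g)%:R.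
Proof. by rewrite /ga_fun ffunE. Qed.
Lemma ga_fun_mul a b g :
  ga_fun (ga_mul a b) g = \sum_h ga_fun a h * ga_fun b (g - h).
Proof. by rewrite {1}/ga_fun ffunE. Qed.

Lemma ga_mulC : commutative ga_mul.
Proof.
move=> a b; apply: ga_ext => g; rewrite !ga_fun_mul.
rewrite (reindex_inj (subrI g)) /=; apply: eq_bigr => h _.
by rewrite subKr mulrC.
Qed.

Lemma ga_mulA : associative ga_mul.
Proof.
move=> a b c; apply: ga_ext => g; rewrite !ga_fun_mul.
under eq_bigr do rewrite ga_fun_mul big_distrr.
under [RHS]eq_bigr do rewrite ga_fun_mul big_distrl.
rewrite [RHS]exchange_big /=; apply: eq_bigr => h _.
rewrite [RHS](reindex_inj (addrI h)) /=; apply: eq_bigr => k _.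
by rewrite mulrA [h + k]addrC addrK opprD addrA addrAC.
Qed.

Lemma ga_delta_mul_fun g b h : ga_fun (ga_mul (ga_delta g) b) h = ga_fun b (h - g).
Proof.
rewrite ga_fun_mul (bigD1 g) //= ga_fun_delta eqxx mul1r big1 ?addr0 // => k kg.
by rewrite ga_fun_delta (negbTE kg) mul0r.
Qed.

Lemma ga_mul1 : left_id (ga_delta 0) ga_mul.
Proof. by move=> a; apply: ga_ext => g; rewrite ga_delta_mul_fun subr0. Qed.

Lemma ga_mulDl : left_distributive ga_mul +%R.
Proof.
move=> a b c; apply: ga_ext => g.
rewrite ga_funD !ga_fun_mul -big_split; apply: eq_bigr => h _.
by rewrite ga_funD mulrDl.
Qed.

Lemma ga_delta_neq0 g : ga_delta g != 0.
Proof.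
apply/eqP => /(congr1 (ga_fun ^~ g)); rewrite ga_fun_delta ga_fun0 eqxx.
exact/eqP/oner_neq0.
Qed.

HB.instance Definition _ := GRing.Zmodule_isComNzRing.Build group_algebra
  ga_mulA ga_mulC ga_mul1 ga_mulDl (ga_delta_neq0 0).

Lemma ga_delta0 : ga_delta 0 = 1. Proof. by []. Qed.

Lemma ga_deltaM_fun g b h : ga_fun (ga_delta g * b) h = ga_fun b (h - g).
Proof. exact: ga_delta_mul_fun. Qed.

Lemma ga_deltaD g h : ga_delta (g + h) = ga_delta g * ga_delta h.
Proof.
by apply: ga_ext => k; rewrite ga_deltaM_fun !ga_fun_delta subr_eq addrC.
Qed.

Lemma ga_delta_inj : injective ga_delta.
Proof.
move=> g h /(congr1 (ga_fun ^~ g)); rewrite !ga_fun_delta eqxx.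
by case: eqP => // _ /eqP; rewrite oner_eq0.
Qed.

Lemma ga_funMn a g k : ga_fun (a *+ k) g = ga_fun a g *+ k.
Proof. by elim: k => [|k IHk]; rewrite ?ga_fun0 // !mulrS ga_funD IHk. Qed.

Definition ga_augmentation a : A := \sum_g ga_fun a g.

Lemma ga_augD a b : ga_augmentation (a + b) = ga_augmentation a + ga_augmentation b.
Proof. by rewrite /ga_augmentation -big_split; apply: eq_bigr => g _; rewrite ga_funD. Qed.

Lemma ga_augN a : ga_augmentation (- a) = - ga_augmentation a.
Proof. by rewrite /ga_augmentation -sumrN; apply: eq_bigr => g _; rewrite ga_funN. Qed.

Lemma ga_aug_deltaM g b : ga_augmentation (ga_delta g * b) = ga_augmentation b.
Proof.
rewrite /ga_augmentation (reindex_inj (addIr g)); apply: eq_bigr => h _.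
by rewrite ga_deltaM_fun addrK.
Qed.

Lemma ga_aug1 : ga_augmentation 1 = 1.
Proof.
rewrite /ga_augmentation (bigD1 0) //= ga_fun_delta eqxx big1 ?addr0 // => k k0.
by rewrite ga_fun_delta (negbTE k0).
Qed.

Definition ga_linear_ext (phi : G -> group_algebra) a : group_algebra :=
  [ffun u => \sum_g ga_fun a g * ga_fun (phi g) u].

Lemma ga_lin_fun phi a u :
  ga_fun (ga_linear_ext phi a) u = \sum_g ga_fun a g * ga_fun (phi g) u.
Proof. by rewrite {1}/ga_fun ffunE. Qed.

Lemma ga_linB phi a b : ga_linear_ext phi (a - b) = ga_linear_ext phi a - ga_linear_ext phi b.
Proof.
apply: ga_ext => u; rewrite ga_funD ga_funN !ga_lin_fun -sumrB.
by apply: eq_bigr => g _; rewrite ga_funD ga_funN mulrBl.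
Qed.

Lemma ga_linD phi a b : ga_linear_ext phi (a + b) = ga_linear_ext phi a + ga_linear_ext phi b.
Proof.
apply: ga_ext => u; rewrite ga_funD !ga_lin_fun -big_split.
by apply: eq_bigr => g _; rewrite ga_funD mulrDl.
Qed.

Lemma ga_lin_delta phi g : ga_linear_ext phi (ga_delta g) = phi g.
Proof.
apply: ga_ext => u; rewrite ga_lin_fun (bigD1 g) //= ga_fun_delta eqxx mul1r.
by rewrite big1 ?addr0 // => k kg; rewrite ga_fun_delta (negbTE kg) mul0r.
Qed.

Lemma ga_lin_shift phi g a :
  ga_linear_ext (fun h => phi (h + g)) a = ga_linear_ext phi (ga_delta g * a).
Proof.
apply: ga_ext => u; rewrite !ga_lin_fun [RHS](reindex_inj (addIr g)) /=.
by apply: eq_bigr => h _; rewrite ga_deltaM_fun addrK.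
Qed.

Lemma ga_lin_mul a b : ga_linear_ext (fun g => ga_delta g * b) a = a * b.
Proof.
apply: ga_ext => u; rewrite ga_lin_fun [RHS]ga_fun_mul.
by apply: eq_bigr => h _; rewrite ga_deltaM_fun.
Qed.

Lemma ga_linBfun phi psi a :
  ga_linear_ext (fun g => phi g - psi g) a = ga_linear_ext phi a - ga_linear_ext psi a.
Proof.
apply: ga_ext => u; rewrite ga_funD ga_funN !ga_lin_fun -sumrB.
by apply: eq_bigr => g _; rewrite ga_funD ga_funN mulrBr.
Qed.

Lemma ga_linDfun phi psi a :
  ga_linear_ext (fun g => phi g + psi g) a = ga_linear_ext phi a + ga_linear_ext psi a.
Proof.
apply: ga_ext => u; rewrite ga_funD !ga_lin_fun -big_split.
by apply: eq_bigr => g _; rewrite ga_funD mulrDr.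
Qed.

End GroupAlgebra.

(** * The Magnus embedding of the quotient by K2 *)

Lemma expg_ordD m (H : groupType) (u : H) (a b : 'I_m.+2) :
  (u ^+ m.+2 = 1)%g -> (u ^+ (a + b)%R = u ^+ a * u ^+ b)%g.
Proof.
move=> un; rewrite -expgnDr /= {2}(divn_eq (a + b)%N m.+2) expgnDr mulnC expgnA un.
by rewrite expg1n mul1g.
Qed.

(** The product is renamed so that it carries both its finite and its additive
structure. *)
Definition square_group (A : finZmodType) : Type := (A * A)%type.
HB.instance Definition _ A := Finite.copy (square_group A) (A * A)%type.
HB.instance Definition _ A := GRing.Zmodule.copy (square_group A) (A * A)%type.

Section Level.
Variable m : nat.
Let n := m.+2.
Let A : comNzRingType := 'I_m.+2.
Let G : finZmodType := square_group 'I_m.+2.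
Let R : comNzRingType := group_algebra G A.
(* With trivial action, Fox derivatives are the exponent sums modulo n. *)
Variables i j : F -> A.
Hypothesis fij : fox_pair (fun _ => 1) i j.

Let N := NormalSubgroup (K2_normal n).
Local Notation pi := (coset N).

Definition exponents (f : F) : G := (i f, j f).
Definition tau (g : G) : F := (gx ^+ (g.1 : 'I_m.+2) * gy ^+ (g.2 : 'I_m.+2))%g.

Lemma exponentsM f g : exponents (f * g)%g = exponents f + exponents g.
Proof. by rewrite /exponents (fox_crossed1 fij) (fox_crossed2 fij) !mul1r. Qed.

Lemma exponents1 : exponents 1%g = 0.
Proof. by apply: (addrI (exponents 1%g)); rewrite -exponentsM mulg1 addr0. Qed.

Lemma exponentsV f : exponents f^-1%g = - exponents f.
Proof. by apply/eqP; rewrite -addr_eq0 -exponentsM mulVg exponents1. Qed.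

Lemma exponentsX f k : exponents (f ^+ k)%g = exponents f *+ k.
Proof.
by elim: k => [|k IHk]; rewrite ?exponents1 // expgS exponentsM IHk mulrS.
Qed.

Lemma exponents_gx : exponents gx = (1, 0).
Proof. by rewrite /exponents (fox1x fij) (fox2x fij). Qed.
Lemma exponents_gy : exponents gy = (0, 1).
Proof. by rewrite /exponents (fox1y fij) (fox2y fij). Qed.

Lemma tau_exponents g : exponents (tau g) = g.
Proof.
case: g => g1 g2; rewrite exponentsM !exponentsX exponents_gx exponents_gy /=.
have E1 (a b : 'I_m.+2) k : ((a, b) : G) *+ k = (a *+ k, b *+ k).
  by elim: k => // k IHk; rewrite !mulrS IHk.
by rewrite !E1 !mul0rn !natr_Zp; congr (_, _); rewrite ?addr0 ?add0r.
Qed.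

Lemma tau0 : tau 0 = 1%g. Proof. by rewrite /tau /= mul1g. Qed.

Definition monomial (f : F) : R := ga_delta A (exponents f).

Lemma monomial_mul : multiplicative_map monomial.
Proof.
by split=> [|f g]; rewrite /monomial ?exponents1 // exponentsM ga_deltaD.
Qed.

Lemma K1_exponents f : K1 n f -> exponents f = 0.
Proof.
have me := fox_mul fij.
have n0 : n%:R = 0 :> A.
  exact: (@pchar_Zp m.+2 isT).
case=> u Hu [v Hv <-]; rewrite exponentsM /exponents.
have [|_ ->] := crossed_hom_derived me (fox_crossed1 fij) (H := setT) _ Hu => //.
have [|_ ->] := crossed_hom_derived me (fox_crossed2 fij) (H := setT) _ Hu => //.
have T : is_subgroup [set: F] by [].
have [|_ ->] := crossed_hom_power me (fox_crossed1 fij) T _ n0 Hv => //.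
have [|_ ->] := crossed_hom_power me (fox_crossed2 fij) T _ n0 Hv => //.
by rewrite addr0.
Qed.

(** F/K1 is abelian of exponent n, so [tau] induces a homomorphism to it, which
inverts [exponents] because it does so on the generators. *)
Lemma exponents_K1 f : exponents f = 0 -> K1 n f.
Proof.
pose M := NormalSubgroup (derived_power_normal n (setT_normal F)).
have MK : derived_power n [set: F] `<=` normal_set M by move=> x.
have xn u : (coset M u ^+ n = 1)%g by apply: (coset_expn MK).
have cc u v : commute (coset M u) (coset M v) by apply: (coset_commute MK).
have tauD g h : coset M (tau (g + h)) = (coset M (tau g) * coset M (tau h))%g.
  rewrite /tau !cosetM !cosetX !expg_ordD // !mulgA; congr (_ * _)%g.
  by rewrite -!mulgA; congr (_ * _)%g; apply: commuteX2.
have E : coset M =1 (fun f => coset M (tau (exponents f))).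
  apply: free_group_morph_ext => [|u v|].
  - exact: cosetM.
  - by rewrite exponentsM tauD.
  - apply: ord2_ind; rewrite -/gx -/gy ?exponents_gx ?exponents_gy /tau /=.
      by rewrite mulg1 expg1.
    by rewrite mul1g expg1.
move=> f0; have := E f; rewrite f0 tau0 => /esym/eq_coset.
by rewrite invg1 mul1g.
Qed.

(** The Cayley graph of [G] has an edge from [g] to [g + exponents (fg_gen t)]
for each pair [(g, t)]. This loop goes to [g] along [tau], through the edge,
and back along [tau]; these are the Schreier generators of K1. *)
Definition edge_loop (k : G * 'I_2) : F :=
  (tau k.1 * fg_gen k.2 * (tau (k.1 + exponents (fg_gen k.2)))^-1)%g.

Lemma edge_loop_exponents k : exponents (edge_loop k) = 0.
Proof.
rewrite [LHS]exponentsM exponentsV [exponents (tau _ * _)%g]exponentsM.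
by rewrite !tau_exponents subrr.
Qed.

(** A 1-chain [c] with coefficients in Z/n becomes a product of powers of edge
loops, well behaved modulo K2 because the loops lie in K1. *)
Definition cycle_word (c : G * 'I_2 -> 'I_m.+2) : F :=
  (\prod_k edge_loop k ^+ c k)%g.

Lemma pi_cycle_word c : pi (cycle_word c) = (\prod_k pi (edge_loop k) ^+ c k)%g.
Proof.
rewrite /cycle_word (big_morph pi (@cosetM _ N) (coset1 N)).
by apply: eq_bigr => k _; rewrite cosetX.
Qed.

Let NK2 : derived_power n (K1 n) `<=` normal_set N. Proof. by move=> x. Qed.

Lemma edge_loop_commute k l : commute (pi (edge_loop k)) (pi (edge_loop l)).
Proof. by apply: (coset_commute NK2); apply/exponents_K1/edge_loop_exponents. Qed.

Lemma edge_loop_expn k : (pi (edge_loop k) ^+ m.+2 = 1)%g.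
Proof. by apply: (coset_expn NK2); apply/exponents_K1/edge_loop_exponents. Qed.

Lemma cycle_wordD c d :
  pi (cycle_word (fun k => c k + d k)) =
  (pi (cycle_word c) * pi (cycle_word d))%g.
Proof.
rewrite !pi_cycle_word -prodgM_commute; last first.
  by move=> *; apply: commuteX2; apply: edge_loop_commute.
by apply: eq_bigr => k _; rewrite expg_ordD // edge_loop_expn.
Qed.

Lemma cycle_word1 k0 :
  pi (cycle_word (fun k => (k == k0)%:R)) = pi (edge_loop k0).
Proof.
rewrite pi_cycle_word.
rewrite [RHS](_ : _ = (\prod_(k | k == k0) pi (edge_loop k))%g).
  rewrite [RHS]big_mkcond; apply: eq_bigr => k _.
  by case: eqP => _; rewrite ?expg1 ?expg0.
by rewrite big_pred1_eq.
Qed.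

Lemma cycle_word0 c : (forall k, c k = 0) -> cycle_word c = 1%g.
Proof. by move=> c0; rewrite /cycle_word big1 // => k _; rewrite c0. Qed.

Variables D1 D2 : F -> R.
Hypothesis fD : fox_pair monomial D1 D2.

(** The 1-chain traced by the word [f] in the Cayley graph. *)
Definition fox_chain (f : F) (k : G * 'I_2) : 'I_m.+2 :=
  ga_fun (if k.2 == ord0 then D1 f else D2 f) k.1.

Lemma fox_chain_gen f t :
  fox_chain (f * fg_gen t)%g =
  (fun k => fox_chain f k + (k == (exponents f, t))%:R).
Proof.
apply/funext => -[g u]; rewrite /fox_chain /=.
rewrite (fox_crossed1 fD) (fox_crossed2 fD) xpair_eqE.
have dM (b : bool) : ga_fun (monomial f * b%:R) g = ((g == exponents f) && b)%:R.
  case: b; first by rewrite mulr1 ga_fun_delta andbT.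
  by rewrite mulr0 ga_fun0 andbF.
have E1 : forall t, D1 (fg_gen t) = (t == ord0)%:R.
  by apply: ord2_ind; rewrite -/gx -/gy ?(fox1x fD) ?(fox1y fD).
have E2 : forall t, D2 (fg_gen t) = (t == ord_max)%:R.
  by apply: ord2_ind; rewrite -/gx -/gy ?(fox2x fD) ?(fox2y fD).
rewrite E1 E2; move: u; apply: ord2_ind; rewrite /= ga_funD dM.
  by rewrite [ord0 == t]eq_sym.
by rewrite [ord_max == t]eq_sym.
Qed.

(** Schreier rewriting: a word is, up to the final return along [tau], the
product of the loops of the edges that it traverses, and modulo K2 their order
is irrelevant. Both sides change in the same way when a generator is appended,
which gives an equivalence at each step and so handles inverse letters too. *)
Lemma cycle_word_fox_chain f :
  pi (cycle_word (fox_chain f)) = pi (f * (tau (exponents f))^-1)%g.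
Proof.
pose P g := pi (cycle_word (fox_chain g)) = pi (g * (tau (exponents g))^-1)%g.
suff H g : forall h, P (h * g)%g <-> P h.
  rewrite -/(P f) -[f]mul1g H /P exponents1 tau0 mulgV cycle_word0 // => k.
  rewrite /fox_chain (crossed_hom1 (fox_mul fD) (fox_crossed1 fD)).
  by rewrite (crossed_hom1 (fox_mul fD) (fox_crossed2 fD)) if_same ga_fun0.
apply: (@free_group_generated _ [set g | forall h, P (h * g)%g <-> P h]) => [|t].
  split=> [h|a b /= Pa Pb h|a /= Pa h]; first by rewrite mulg1.
    by rewrite mulgA Pb Pa.
  by rewrite -(Pa (h * a^-1)%g) mulgVK.
move=> h; rewrite /P fox_chain_gen cycle_wordD cycle_word1.
have -> : (h * fg_gen t * (tau (exponents (h * fg_gen t)))^-1 =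
  h * (tau (exponents h))^-1 * edge_loop (exponents h, t))%g.
  rewrite /edge_loop /= exponentsM; move: (tau _) (tau (_ + _)) => u v.
  by rewrite !mulgA mulgVK.
rewrite [pi (_ * edge_loop _)%g]cosetM.
by split=> [/mulIg|->].
Qed.

Lemma fox_kernel f : exponents f = 0 -> D1 f = 0 -> D2 f = 0 -> pi f = 1%g.
Proof.
move=> f0 D1f D2f; have := cycle_word_fox_chain f.
rewrite f0 tau0 invg1 mulg1 => <-; rewrite cycle_word0 ?coset1 // => k.
by rewrite /fox_chain D1f D2f if_same ga_fun0.
Qed.

(** By the fundamental formula the Fox derivatives also determine the image in
the group algebra, hence the exponents; so [fox_kernel] applies to the
quotient of [f] and [g]. *)
Lemma fox_injective f g : D1 f = D1 g -> D2 f = D2 g -> pi f = pi g.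
Proof.
move=> E1 E2; have me := fox_mul fD.
have e_eq : monomial f = monomial g.
  apply: (addIr (- 1)).
  by rewrite (fox_fundamental fD f) (fox_fundamental fD g) E1 E2.
have b_eq := ga_delta_inj e_eq.
suff : pi (g^-1 * f)%g = 1%g.
  rewrite cosetM cosetV => h; apply: (@mulgI _ (pi g)^-1%g).
  by rewrite h mulVg.
apply: fox_kernel; first by rewrite exponentsM exponentsV b_eq addNr.
- by rewrite (fox_crossed1 fD) (crossed_homV me (fox_crossed1 fD)) E1 addNr.
- by rewrite (fox_crossed2 fD) (crossed_homV me (fox_crossed2 fD)) E2 addNr.
Qed.

(** The value on an edge loop is that of the edge plus the difference between
the values of [tau] at its two ends, so on a chain it is the value of the chain
minus the sum of [D \o tau] over the boundary. *)
Lemma crossed_hom_cycle_word (D : F -> R) (a b : R) : crossed_hom monomial D ->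
  D (cycle_word (fun k => ga_fun (if k.2 == ord0 then a else b) k.1)) =
  a * D gx + b * D gy
  - ga_linear_ext (D \o tau) (a * (monomial gx - 1) + b * (monomial gy - 1)).
Proof.
move=> cD; have me := monomial_mul; have [e1 eM] := me.
have loopD k : D (edge_loop k) = (D (tau k.1) + ga_delta A k.1 * D (fg_gen k.2))
    - D (tau (k.1 + exponents (fg_gen k.2))).
  apply: (addIr (D (tau (k.1 + exponents (fg_gen k.2))))); rewrite subrK.
  rewrite -[X in _ + X]mul1r -[X in X * _](_ : monomial (edge_loop k) = 1).
    by rewrite -cD /edge_loop mulgVK cD /monomial tau_exponents.
  by rewrite /monomial edge_loop_exponents.
set c := fun k => _.
have [_ ->] : monomial (cycle_word c) = 1 /\
    D (cycle_word c) = \sum_k D (edge_loop k) *+ (c k : 'I_m.+2).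
  apply: (big_ind2 (fun f r => monomial f = 1 /\ D f = r)).
  - by rewrite e1 (crossed_hom1 me cD).
  - by move=> f r g s [ef Df] [eg Dg]; rewrite eM cD ef eg Df Dg !mul1r.
  - move=> k _; have loop1 : monomial (edge_loop k) = 1.
      by rewrite /monomial edge_loop_exponents.
    elim: (nat_of_ord _) => [|l [IHe IHD]].
      by rewrite e1 (crossed_hom1 me cD).
    by rewrite expgS eM cD loop1 IHe IHD !mul1r mulrS.
have lin (t : 'I_2) a' : \sum_g D (edge_loop (g, t)) *+ (ga_fun a' g : 'I_m.+2) =
    a' * D (fg_gen t) - ga_linear_ext (D \o tau) (a' * (monomial (fg_gen t) - 1)).
  transitivity (ga_linear_ext (fun g => D (edge_loop (g, t))) a').
    apply: ga_ext => u; rewrite ga_lin_fun.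
    rewrite (big_morph (fun r : R => ga_fun r u) (fun r s => ga_funD r s u)
      (ga_fun0 A u)).
    by apply: eq_bigr => g _; rewrite ga_funMn -mulr_natl natr_Zp.
  rewrite (_ : (fun g => _) =
    (fun g => ((D \o tau) g + ga_delta A g * D (fg_gen t)) -
      (D \o tau) (g + exponents (fg_gen t)))); last by apply/funext => g; rewrite loopD.
  rewrite ga_linBfun ga_linDfun ga_lin_mul ga_lin_shift.
  rewrite mulrBr mulr1 ga_linB [a' * monomial _]mulrC opprB.
  by rewrite -addrA addrCA.
transitivity (\sum_g \sum_t D (edge_loop (g, t)) *+ (c (g, t) : 'I_m.+2)).
  by rewrite pair_big; apply: eq_bigr => -[g t] _.
rewrite exchange_big big_ord_recl big_ord1 /=.
rewrite (_ : lift ord0 ord0 = ord_max); last exact/val_inj.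
rewrite [X in X + _]lin [X in _ + X]lin -/gx -/gy ga_linD opprD.
exact: addrACA.
Qed.

Lemma monomial_cycle_word c : monomial (cycle_word c) = 1.
Proof.
rewrite /monomial (_ : exponents _ = 0) //.
apply: (big_ind (fun f => exponents f = 0)).
- exact: exponents1.
- by move=> f g f0 g0; rewrite exponentsM f0 g0 addr0.
- by move=> k _; rewrite exponentsX edge_loop_exponents mul0rn.
Qed.

(** The chain [(a, b)] has boundary [h - 1]. In [crossed_hom_cycle_word] the
boundary terms then reduce to the value at [tau (exponents h)], which the last
factor of the witness compensates. *)
Lemma fox_surjective a b h :
  a * (monomial gx - 1) + b * (monomial gy - 1) = monomial h - 1 ->
  exists k, D1 k = a /\ D2 k = b.
Proof.
move=> abh; pose c (k : G * 'I_2) := ga_fun (if k.2 == ord0 then a else b) k.1.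
have key D : crossed_hom monomial D ->
    D (cycle_word c * tau (exponents h))%g = a * D gx + b * D gy.
  move=> cD; rewrite cD monomial_cycle_word mul1r crossed_hom_cycle_word // abh.
  rewrite ga_linB -ga_delta0 !ga_lin_delta /= tau0.
  rewrite (crossed_hom1 monomial_mul cD) subr0.
  by rewrite subrK.
exists (cycle_word c * tau (exponents h))%g.
rewrite (key D1 (fox_crossed1 fD)) (key D2 (fox_crossed2 fD)).
rewrite (fox1x fD) (fox1y fD) (fox2x fD) (fox2y fD).
by rewrite !mulr0 !mulr1 addr0 add0r.
Qed.

Lemma natr_level0 : n%:R = 0 :> R.
Proof.
apply: ga_ext => g; rewrite ga_funMn ga_fun0 -mulr_natr.
by rewrite (@pchar_Zp m.+2 isT) mulr0.
Qed.

Lemma K2_fox f : normal_set N f -> [/\ monomial f = 1, D1 f = 0 & D2 f = 0].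
Proof.
have me := monomial_mul; have c1 := fox_crossed1 fD; have c2 := fox_crossed2 fD.
have K1e g : K1 n g -> monomial g = 1.
  by move=> /K1_exponents; rewrite /monomial => ->.
have sK : is_subgroup (K1 n).
  by have [] := derived_power_normal n (setT_normal F).
move=> [u Ku [v Kv <-]].
have [eu u1] := crossed_hom_derived me c1 K1e Ku.
have [_ u2] := crossed_hom_derived me c2 K1e Ku.
have [ev v1] := crossed_hom_power me c1 sK K1e natr_level0 Kv.
have [_ v2] := crossed_hom_power me c2 sK K1e natr_level0 Kv.
by split; rewrite ?me.2 ?c1 ?c2 ?eu ?ev ?u1 ?u2 ?v1 ?v2 ?mulr1 ?mulr0 ?addr0.
Qed.

(** These conditions define a subgroup of the quotient, since Fox derivatives
kill K2, and [derived_fox] puts the commutators in it. *)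
Lemma derived_Phi2n_fox f : derived [set: Phi2n n] (pi f) ->
  exists p, D1 f = p * (1 - monomial gy) /\ D2 f = p * (monomial gx - 1).
Proof.
have me := monomial_mul; have c1 := fox_crossed1 fD; have c2 := fox_crossed2 fD.
pose P (X : Phi2n n) := exists g, [/\ pi g = X, monomial g = 1 &
  exists p, D1 g = p * (1 - monomial gy) /\ D2 g = p * (monomial gx - 1)].
suff sub : derived [set: Phi2n n] `<=` P.
  move=> /sub[g [/eq_coset/K2_fox[_ z1 z2] _ [p [p1 p2]]]]; exists p.
  by rewrite (crossed_hom_congr c1 z1) (crossed_hom_congr c2 z2).
apply: smallest_sub; first split.
- exists 1%g; split; rewrite ?me.1 //; exists 0.
  by rewrite (crossed_hom1 me c1) (crossed_hom1 me c2) !mul0r.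
- move=> _ _ [g [<- eg [p [p1 p2]]]] [h [<- eh [q [q1 q2]]]].
  exists (g * h)%g; split; first exact: cosetM.
    by rewrite me.2 eg eh mulr1.
  exists (p + q); rewrite c1 c2 eg p1 p2 q1 q2 !mul1r.
  by rewrite -!mulrDl.
- move=> _ [g [<- eg [p [p1 p2]]]]; exists g^-1%g.
  have egV : monomial g^-1%g = 1 by have := multiplicativeV me g; rewrite eg mulr1.
  split=> //; first exact: cosetV.
  exists (- p); rewrite (crossed_homV me c1) (crossed_homV me c2) egV p1 p2.
  by rewrite !mul1r !mulNr.
move=> _ [X _ [Y _ <-]]; exists [~ repr X, repr Y]%g; split.
- rewrite commgEl conjgE !cosetM !cosetV !(coset_repr X) !(coset_repr Y).
  by rewrite commgEl conjgE.
- apply: (multiplicative_map_derived me); apply: sub_generated.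
  by exists (repr X) => //; exists (repr Y).
- exact: derived_fox fD _ _.
Qed.

(** The augmentation of the left hand side is 1. With the sign -1 this forces
-1 = 1 in Z/n, and then signs are invisible in the group algebra. *)
Lemma IA_jacobian_sign (p q : R) h (a : int) : a = 1 \/ a = -1 ->
  1 + p * (1 - monomial gy) + q * (monomial gx - 1) = a%:~R * monomial h ->
  a%:~R * monomial h = monomial h.
Proof.
have aug0 r g : ga_augmentation (r * (1 - monomial g)) = 0.
  by rewrite mulrBr mulr1 ga_augD ga_augN [r * _]mulrC ga_aug_deltaM subrr.
have -> : monomial gx - 1 = - (1 - monomial gx) by rewrite opprB.
move=> [-> _|-> E]; first by rewrite mul1r.
have : ga_augmentation (- monomial h) = 1.
  by rewrite -mulN1r -E !ga_augD mulrN ga_augN !aug0 ga_aug1 oppr0 !addr0.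
rewrite ga_augN -[monomial h]mulr1 ga_aug_deltaM ga_aug1 => N1.
rewrite mulr1 mulN1r; apply: ga_ext => u.
by rewrite ga_funN -mulN1r N1 mul1r.
Qed.

End Level.

(** * IA-automorphisms are inner *)

Section JacobianNormalForm.
Variables (S : comNzRingType) (e D1 D2 : F -> S).
Hypothesis fD : fox_pair e D1 D2.
Add Ring S_ring : (comRing_theory S).

Variables (X Y : F) (p q : S).
Hypotheses (X1 : D1 X = 1 + p * (1 - e gy)) (X2 : D2 X = p * (e gx - 1)).
Hypotheses (Y1 : D1 Y = q * (1 - e gy)) (Y2 : D2 Y = 1 + q * (e gx - 1)).

Lemma jacobian_IA : jacobian D1 D2 X Y = 1 + p * (1 - e gy) + q * (e gx - 1).
Proof. by rewrite /jacobian X1 X2 Y1 Y2; fold_ring S; ring. Qed.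

(** The fundamental formula gives [e k = 1 + q * (e gx - 1) - p * (e gy - 1)],
so that the Fox matrix of conjugation by [k] has exactly the entries of the
Fox matrix of [gx |-> X], [gy |-> Y]. *)
Lemma conj_IA k : D1 k = q -> D2 k = - p ->
  [/\ D1 (k * gx * k^-1)%g = D1 X, D2 (k * gx * k^-1)%g = D2 X,
      D1 (k * gy * k^-1)%g = D1 Y & D2 (k * gy * k^-1)%g = D2 Y].
Proof.
move=> k1 k2; have [me c1 c2 x1 y1 x2 y2] := fD.
have ek : e k = 1 + q * (e gx - 1) + - p * (e gy - 1).
  by rewrite -addrA -k1 -k2 -(fox_fundamental fD) addrC subrK.
have eJ g : e (k * g * k^-1)%g = e g.
  by rewrite !me.2 mulrC mulrA multiplicativeV // mul1r.
rewrite !(crossed_homJ me c1) !(crossed_homJ me c2) !eJ ek k1 k2.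
rewrite X1 X2 Y1 Y2 x1 x2 y1 y2.
by split; fold_ring S; ring.
Qed.

End JacobianNormalForm.

Lemma Aut_Phi2_lift f : Aut Phi2 f -> exists s t : F -> F,
  [/\ {morph s : u v / (u * v)%g},
      forall u, coset F_second_derived (s u) = f (coset F_second_derived u) &
      forall u, normal_set F_second_derived (u^-1 * s (t u))%g].
Proof.
pose pi := coset F_second_derived.
have lift (g : Phi2 -> Phi2) : {morph g : X Y / (X * Y)%g} ->
    exists2 s : F -> F,
      {morph s : u v / (u * v)%g} & forall u, pi (s u) = g (pi u).
  move=> gM.
  have [s [[sM sg] _]] :=
    free_group_universal (fun t : 'I_2 => repr (g (pi (fg_gen t))) : F).
  exists s => //; apply: (@free_group_morph_ext _ _ (pi \o s) (g \o pi)).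
  - by move=> u v /=; rewrite sM /pi cosetM.
  - by move=> u v /=; rewrite /pi cosetM gM.
  - by move=> t /=; rewrite sg /pi coset_repr.
move=> [fM [g fK gK]].
have gM : {morph g : X Y / (X * Y)%g}.
  by move=> X Y; rewrite -{1}[X]gK -{1}[Y]gK -fM fK.
have [s sM sE] := lift f fM; have [t tM tE] := lift g gM.
exists s, t; split=> // u; apply/eq_coset.
by rewrite -/pi sE tE gK.
Qed.

Lemma Inn_sub_IA' n : Inn (Phi2n n) `<=` IA' n.
Proof.
move=> _ [g ->].
have autJ (G : groupType) (h : G) : Aut G (fun x => x ^ h)%g.
  split=> [x y|]; first exact: conjMg.
  by exists (fun x => x ^ h^-1)%g => x; rewrite ?conjgK ?conjgKV.
split; split; try exact: autJ.
  move=> X /=; apply/esym/eq_coset.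
  by apply: sub_generated; exists X => //; exists g.
have gE := coset_repr g; move: (repr g) gE => v <-.
exists (fun X : Phi2 => X ^ coset F_second_derived v)%g; first exact: autJ.
move=> X /=; rewrite -(coset_repr X); move: (repr X) => u.
rewrite natural_mapE !conjgE -!cosetV.
by rewrite -!(cosetM _ u v) -!(cosetM _ v^-1%g) natural_mapE.
Qed.

Lemma IA'_sub_Inn m : IA' m.+2 `<=` Inn (Phi2n m.+2).
Proof.
move=> al [[[alM al_bij] alIA] [_ [f Af fal]]].
have [s [t [sM sf st]]] := Aut_Phi2_lift Af.
pose N := NormalSubgroup (K2_normal m.+2); pose pi := coset N.
have pis u : pi (s u) = al (pi u) by rewrite /pi -!natural_mapE sf fal.
have m1 : multiplicative_map (fun _ : F => 1 : 'I_m.+2).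
  by split=> // u v; rewrite mulr1.
have [i [j fij]] := fox_pair_exists m1.
have me := monomial_mul fij.
have [D1 [D2 fD]] := fox_pair_exists me.
set e := monomial i j in me fD.
have c1 := fox_crossed1 fD; have c2 := fox_crossed2 fD.
have IAs u : exists p, D1 (s u) = D1 u + p * (1 - e gy) /\
                       D2 (s u) = D2 u + p * (e gx - 1).
  have : derived [set: Phi2n m.+2] (pi (u^-1 * s u)%g).
    rewrite /pi cosetM cosetV -/pi pis.
    by apply/(eq_coset (derived_group (Phi2n m.+2))); rewrite (alIA (pi u)).
  move=> /(derived_Phi2n_fox fij fD) [p [p1 p2]]; exists (e u * p).
  by rewrite -[s u](mulVKg u) c1 c2 p1 p2 !mulrA.
have [p [p1 p2]] := IAs gx; have [q [q1 q2]] := IAs gy.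
rewrite (fox1x fD) in p1; rewrite (fox2x fD) add0r in p2.
rewrite (fox1y fD) add0r in q1; rewrite (fox2y fD) in q2.
have [a [h [a1 J]]] := jacobian_automorphism fD sM st.
rewrite (jacobian_IA p1 p2 q1 q2) in J.
have Jh := J; rewrite (IA_jacobian_sign a1 J) in Jh.
have [|k [k1 k2]] := fox_surjective fij fD (a := q) (b := - p) (h := h).
  rewrite -Jh -/e -[e gy - 1]opprB mulrNN [RHS]addrC.
  by rewrite -[1 + _ + _]addrA addKr addrC.
have [E1 E2 E3 E4] := conj_IA fD p1 p2 q1 q2 k1 k2.
exists (pi k^-1%g); apply/funext => X; rewrite -(coset_repr X).
move: (repr X) => u.
apply: (@free_group_morph_ext _ _ (al \o pi) (fun u => pi u ^ pi k^-1)%g).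
- by move=> v w /=; rewrite /pi cosetM alM.
- by move=> v w /=; rewrite /pi cosetM conjMg.
- have conjE v : (pi v ^ pi k^-1)%g = pi (k * v * k^-1)%g.
    by rewrite conjgE /pi !cosetM !cosetV invgK mulgA.
  by apply: ord2_ind; rewrite /= -/gx -/gy conjE -pis;
    apply: (fox_injective fij fD).
Qed.

Lemma Phi2n1_trivial (X Y : Phi2n 1) : X = Y.
Proof.
have pow (H : set F) : H `<=` derived_power 1 H.
  by move=> u Hu; apply/power_sub_power; apply: sub_generated; exists u.
rewrite -(coset_repr X) -(coset_repr Y); apply/eq_coset.
by apply/pow/pow.
Qed.

Theorem theorem5p8 (n : nat) (n_gt0 : (0 < n)%N) : IA' n = Inn (Phi2n n).
Proof.
apply/seteqP; split; last exact: Inn_sub_IA'.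
case: n n_gt0 => [//|[|m]] _; last exact: IA'_sub_Inn.
by move=> al _; exists 1%g; apply/funext => X; apply: Phi2n1_trivial.
Qed.
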